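(* Let $G$ be a locally compact Abelian group and let $\Omega_{+},\Omega_{-}\subset G$ be boundary-coherent symmetric subsets with $\Omega_{+}$ a neighbourhood of $0$. Then $$\mathcal{F}_{G}(\Omega_{+},\Omega_{-})=\mathcal{F}_{G}(\operatorname{int}\Omega_{+},\operatorname{int}\Omega_{-})=\mathcal{F}_{G}(\overline{\operatorname{int}\Omega_{+}},\overline{\operatorname{int}\Omega_{-}})=\mathcal{F}^{*}_{G}(\overline{\operatorname{int}\Omega_{+}},\overline{\operatorname{int}\Omega_{-}})=\mathcal{F}^{*}_{G}(\overline{\Omega_{+}},\overline{\Omega_{-}}).$$
   Context: All locally compact Abelian (LCA) groups are Hausdorff, written additively with identity $0$, and $\lambda_G$ denotes a fixed Haar measure on $G$. A set $\Omega\subset G$ is symmetric if $\Omega=-\Omega$. A neighbourhood of $0$ is a set containing an open set that contains $0$. $\operatorname{int}$ denotes interior. Here $A \subset B$ does not mean strict inclusion. A function $f:G\to\mathbb{R}$ is positive definite if $\sum_{i=1}^{n}\sum_{j=1}^{n}c_i\overline{c_j}f(g_i-g_j)\ge 0$ for all $n\in\mathbb{N}$, $c_i\in\mathbb{C}$, $g_i\in G$. $P_1(G)$ is the set of continuous positive definite functions $f:G\to\mathbb{R}$ with $f(0)=1$. Write $f_+:=\max\{f,0\}$, $f_-:=\max\{-f,0\}$, and $\operatorname{supp} f:=\overline{\{g\in G: f(g)\neq 0\}}$. For subsets $\Omega_+,\Omega_-\subset G$, $$\mathcal{F}_{G}(\Omega_{+},\Omega_{-}):=\{f\in P_1(G)\cap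 L^1(G): f^{-1}((0,\infty))\subset\Omega_{+},\ f^{-1}((-\infty,0))\subset\Omega_{-}\},$$ $$\mathcal{F}^{*}_{G}(\Omega_{+},\Omega_{-}):=\{f\in P_1(G)\cap L^1(G): \operatorname{supp} f_+\subset\Omega_{+},\ \operatorname{supp} f_-\subset\Omega_{-}\}.$$ A subset $\Omega$ of a topological space $X$ is boundary-coherent if $\partial\Omega\subset\overline{\operatorname{ext}\Omega}$, where $\operatorname{ext}\Omega:=X\setminus\overline{\Omega}$. *)

(* Defs.v *)
From HB Require Import structures.
From mathcomp Require Import all_boot all_order all_algebra.
From mathcomp Require Import complex.
From mathcomp Require Import all_classical all_reals all_analysis.

Set Implicit Arguments.
Unset Strict Implicit.
Unset Printing Implicit Defensive.

Import Order.TTheory GRing.Theory Num.Theory.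
Import numFieldNormedType.Exports.

Local Open Scope classical_set_scope.
Local Open Scope ring_scope.

Section boundary_coherent.
Context {X : topologicalType}.
Implicit Types A : set X.

Definition boundary A : set X := closure A `\` A°.

Definition exterior A : set X := ~` closure A.

Definition boundary_coherent A : Prop := boundary A `<=` closure (exterior A).

End boundary_coherent.

Definition symmetric_set (G : zmodType) (A : set G) : Prop :=
  A = [set - x | x in A].

(* A copy of G carrying the Borel sigma-algebra. A measurableType is pointed,
   which a topologicalZmodType is not by itself; the point chosen is 0. *)
Definition borelType (G : topologicalZmodType) : Type := G.

Section borelType.
Variable G : topologicalZmodType.

HB.instance Definition _ := Choice.on (borelType G).
HB.instance Definition _ := isPointed.Build (borelType G) (0 : G).

Lemma borel_setC (A : set (borelType G)) :
  <<s (@open G) >> A -> <<s (@open G) >> (~` A).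
Proof. by move=> sA; rewrite -setTD; exact: sigma_algebraCD. Qed.

HB.instance Definition _ := @isMeasurable.Build (sigma_display (@open G))
  (borelType G) <<s (@open G) >> (@sigma_algebra0 _ setT (@open G))
  borel_setC (@sigma_algebra_bigcup _ setT (@open G)).

End borelType.

(* Haar measures are taken to be outer regular on Borel sets and inner regular
   on open sets. *)
Definition haar_measure (R : realType) (G : topologicalZmodType)
    (mu : {measure set (borelType G) -> \bar R}) : Prop :=
  [/\ mu setT != 0%E,
      forall (g : G) (A : set (borelType G)), measurable A ->
        mu [set g + x | x in A] = mu A,
      forall K : set G, compact K -> (mu K < +oo)%E,
      forall A : set (borelType G), measurable A ->
        mu A = ereal_inf [set mu U | U in [set U : set G | open U /\ A `<=` U]] &
      forall U : set G, open U ->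
        mu U = ereal_sup
          [set mu K | K in [set K : set G | compact K /\ K `<=` U]] ].

(* In R[i], 0 <= z means that z is real and nonnegative. *)
Definition positive_definite (R : realType) (G : zmodType) (f : G -> R) : Prop :=
  forall (n : nat) (c : 'I_n -> R[i]) (g : 'I_n -> G),
    0 <= \sum_(i < n) \sum_(j < n) c i * (c j)^* * (f (g i - g j))%:C%C.

Definition P1 (R : realType) (G : topologicalZmodType) : set (G -> R) :=
  [set f | [/\ continuous f, positive_definite f & f 0 = 1]].
Arguments P1 : clear implicits.

Definition supp (R : realType) (X : topologicalType) (f : X -> R) : set X :=
  closure [set x | f x != 0].

Section classes.
Context {R : realType} {G : topologicalZmodType}.
Variable mu : {measure set (borelType G) -> \bar R}.

Definition L1 : set (G -> R) :=
  [set f | mu.-integrable setT (EFin \o (f : borelType G -> R))].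

Definition Fclass (Op Om : set G) : set (G -> R) :=
  [set f | [/\ (P1 R G `&` L1) f,
               f @^-1` `]0, +oo[ `<=` Op &
               f @^-1` `]-oo, 0[ `<=` Om]].

Definition Fstar (Op Om : set G) : set (G -> R) :=
  [set f | [/\ (P1 R G `&` L1) f,
               supp (f^\+) `<=` Op &
               supp (f^\-) `<=` Om]].

End classes.

(* Main.v *)
Require Import Defs.
From HB Require Import structures.
From mathcomp Require Import all_boot all_order all_algebra.
From mathcomp Require Import complex.
From mathcomp Require Import all_classical all_reals all_analysis.

Set Implicit Arguments.
Unset Strict Implicit.
Unset Printing Implicit Defensive.

Import Order.TTheory GRing.Theory Num.Theory.
Import numFieldNormedType.Exports.

Local Open Scope classical_set_scope.
Local Open Scope ring_scope.

(* Only the open sets {f > 0} and {f < 0} matter, and a boundary-coherent set A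
   has the same interior as its closure; so A, its interior, the closure of its
   interior and its closure all contain the same open sets. *)

Section same_open_subsets.
Context {X : topologicalType}.
Implicit Types A B C U : set X.

(** This amounts to [A° = B°]; quantifying over open [U] lets it be applied directly to the sign
    sets of a continuous function. *)
Definition same_open_subsets A B := forall U, open U -> U `<=` A <-> U `<=` B.

(** A point of [(closure A)°] outside [A°] is a boundary point, hence adherent to the exterior; but
    [closure A] is a neighbourhood of it that misses the exterior. *)
Lemma boundary_coherent_interior_closure A :
  boundary_coherent A -> (closure A)° = A°.
Proof.
move=> bcA; apply/seteqP; split; last exact/interiorS/subset_closure.
move=> x clAx; apply: contrapT => nAx.
have /bcA : boundary A x by split=> //; exact: interior_subset.
by move=> /(_ _ clAx) [y []].
Qed.

(** An open [U] inside [B] lies in [closure A], hence in the interior of [closure A], which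
    coherence identifies with [A°]. *)
Lemma boundary_coherent_same_open_subsets A B : boundary_coherent A ->
  A° `<=` B -> B `<=` closure A -> same_open_subsets A° B.
Proof.
move=> bcA AB BA U oU; split=> [UA|UB]; first exact: subset_trans AB.
rewrite -boundary_coherent_interior_closure// -open_subsetE//.
exact: subset_trans BA.
Qed.

Lemma supp_subset_closed (R : realType) (h : X -> R) A :
  closed A -> supp h `<=` A <-> [set x | h x != 0] `<=` A.
Proof.
move=> cA; split=> [sA|hA]; first exact: subset_trans (@subset_closure _ _) sA.
by rewrite /supp ((closure_id A).1 cA); exact: closureS.
Qed.

End same_open_subsets.

(** Serves both parts of [f]: [f^\+] is the case of [f x], and [f^\-] that of [- f x]. *)
Lemma max0_neq0 (R : realDomainType) (x : R) : (Num.max x 0 != 0) = (0 < x).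
Proof.
by case: (ltP 0 x) => x0; [rewrite gt_eqF// lt_max x0|rewrite eqxx].
Qed.

Lemma funrpos_neq0 (R : realType) (T : Type) (f : T -> R) :
  [set x | f^\+ x != 0] = f @^-1` `]0, +oo[.
Proof. by apply/seteqP; split=> x /=; rewrite max0_neq0 in_itv/= andbT. Qed.

Lemma funrneg_neq0 (R : realType) (T : Type) (f : T -> R) :
  [set x | f^\- x != 0] = f @^-1` `]-oo, 0[.
Proof. by apply/seteqP; split=> x /=; rewrite max0_neq0 in_itv/= oppr_gt0. Qed.

Section classes.
Context {R : realType} {G : topologicalZmodType}.
Variable mu : {measure set (borelType G) -> \bar R}.
Implicit Types A B : set G.

Lemma Fclass_same_open_subsets A A' B B' :
  same_open_subsets A A' -> same_open_subsets B B' ->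
  Fclass mu A B = Fclass mu A' B'.
Proof.
move=> AA' BB'; apply/seteqP; split=> f [[[cf pf f0] Lf] fA fB];
  (split; [by []|apply/AA' => //|apply/BB' => //]);
  (* The sign sets are preimages of open rays under the continuous [f], hence open. *)
  apply: open_comp => // x _; exact: cf.
Qed.

(** Taking the closure in [supp] costs nothing when the target is closed, and [f^\+], [f^\-] are
    nonzero exactly on the two sign sets. *)
Lemma Fstar_closed A B : closed A -> closed B -> Fstar mu A B = Fclass mu A B.
Proof.
move=> cA cB; apply/seteqP; split=> f [Pf fA fB]; split=> //.
- by rewrite -funrpos_neq0; exact/supp_subset_closed.
- by rewrite -funrneg_neq0; exact/supp_subset_closed.
- by apply/supp_subset_closed => //; rewrite funrpos_neq0.
- by apply/supp_subset_closed => //; rewrite funrneg_neq0.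
Qed.

End classes.

Theorem corollary26 (R : realType) (G : topologicalZmodType)
    (hausG : hausdorff_space G) (lcG : locally_compact [set: G])
    (mu : {measure set (borelType G) -> \bar R}) (haar_mu : haar_measure mu)
    (Op Om : set G)
    (bc_Op : boundary_coherent Op) (bc_Om : boundary_coherent Om)
    (sym_Op : symmetric_set Op) (sym_Om : symmetric_set Om)
    (Op0 : nbhs (0 : G) Op) :
  [/\ Fclass mu Op Om = Fclass mu (Op°) (Om°),
      Fclass mu (Op°) (Om°) = Fclass mu (closure (Op°)) (closure (Om°)),
      Fclass mu (closure (Op°)) (closure (Om°)) =
        Fstar mu (closure (Op°)) (closure (Om°)) &
      Fstar mu (closure (Op°)) (closure (Om°)) =
        Fstar mu (closure Op) (closure Om) ].
Proof.
(* Every pair of sets in the theorem is squeezed in this way, so each class reduces to that of the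
   interiors. *)
have E A B : Op° `<=` A -> A `<=` closure Op -> Om° `<=` B ->
    B `<=` closure Om -> Fclass mu A B = Fclass mu Op° Om°.
  move=> *; apply/esym/Fclass_same_open_subsets;
  exact: boundary_coherent_same_open_subsets.
have intS := @interior_subset G.
have clS := @subset_closure G.
have int_cl (A : set G) : A° `<=` closure A by exact: subset_trans (intS A) (clS A).
have cl_int (A : set G) : closure A° `<=` closure A by exact: (closureS (intS A)).
(* Both starred classes have closures as arguments, so only instances of [Fclass] remain and [E]
   applies. *)
rewrite !Fstar_closed; do ?exact: closed_closure.
by rewrite (E Op Om)// (E (closure Op°) (closure Om°))//
  (E (closure Op) (closure Om)).
Qed.
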